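(* Let $\mathcal{E}$ be an even Dirichlet form on $L^2(X,m)$ with growth type at most $r\ge 2$, let $\mathfrak{D}$ be its Dirichlet space and $\partial\mathcal{E}$ its subgradient. Let $q\ge 2$, $\lambda>0$, $f\in L^2(X,m)\cap L^q(X,m)$, and let $u\in L^2(X,m)$ be the solution of $\partial\mathcal{E}(u)+\lambda u\ni f$, i.e. $(u,f-\lambda u)\in\partial\mathcal{E}$. Let $p\ge 2$ be such that $\left(1-\frac2q\right)\frac pr>1$, and assume that $\mathfrak{D}$ embeds continuously into $L^p(X,m)$. Then $u\in L^\infty(X,m)$.
   Context: Standing setting: $X$ is a Hausdorff topological space and $m$ is a Borel measure on $X$ with full support, i.e. no nonempty open subset of $X$ has $m$-measure zero. $L^2(X,m)$ is the real $L^2$ space with inner product $\langle\cdot,\cdot\rangle_{L^2}$. A Dirichlet form is a functional $\mathcal{E}:L^2(X,m)\to[0,\infty]$ that is convex, lower semicontinuous and densely defined (its effective domain $\mathrm{dom}(\mathcal{E})=\{u:\mathcal{E}(u)<\infty\}$ is dense in $L^2(X,m)$), and such that for all $u,v\in L^2(X,m)$ and $\alpha>0$: (1) $\mathcal{E}(u\wedge v)+\mathcal{E}(u\vee v)\le \mathcal{E}(u)+\mathcal{E}(v)$; (2) $\mathcal{E}\big(v+\tfrac12((u-v+\alpha)_+-(u-v-\alpha)_-)\big)+\mathcal{E}\big(u-\tfrac12((u-v+\alpha)_+-(u-v-\alpha)_-)\big)\le \mathcal{E}(u)+\mathcal{E}(v)$, where $(\cdot)_+$, $(\cdot)_-$ denote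 positive and negative parts. $\mathcal{E}$ is called even if $\mathcal{E}(0)=0$ and $\mathcal{E}(-u)=\mathcal{E}(u)$ for all $u$. A Dirichlet form $\mathcal{E}$ has growth type at most $r$ ($r\ge 2$) if $\mathcal{E}(\lambda u)\le\lambda^r\mathcal{E}(u)$ for every $u\in L^2(X,m)$ and every $\lambda\ge 1$. The subgradient is $\partial\mathcal{E}=\{(u,f)\in L^2\times L^2: u\in\mathrm{dom}(\mathcal{E}),\ \langle f,v-u\rangle_{L^2}\le\mathcal{E}(v)-\mathcal{E}(u)\text{ for all }v\in L^2(X,m)\}$; it is a maximal monotone operator, so for every $\lambda>0$ and $f\in L^2(X,m)$ there is a unique $u$ with $(u,f-\lambda u)\in\partial\mathcal{E}$. Set $\mathcal{E}_1(u)=\|u\|_{L^2(X,m)}^2+\mathcal{E}(u)$. The Dirichlet space is $\mathfrak{D}=\{u\in L^2(X,m):\exists\lambda>0,\ \mathcal{E}_1(\lambda u)<\infty\}$ with the Minkowski norm $\|u\|_{\mathfrak{D}}=\inf\{\lambda>0:\mathcal{E}_1(u/\lambda)\le 1\}$. ''$\mathfrak{D}$ embeds continuously into $L^p$'' means $\mathfrak{D}\subseteq L^p(X,m)$ and $\|u\|_{L^p}\le c\|u\|_{\mathfrak{D}}$ for some $c$ and all $u\in\mathfrak{D}$. *)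

(* Defs.v *)
From HB Require Import structures.
From mathcomp Require Import all_boot all_order all_algebra.
From mathcomp Require Import all_classical all_reals all_analysis.
Set Implicit Arguments.
Unset Strict Implicit.
Unset Printing Implicit Defensive.
Import Order.TTheory GRing.Theory Num.Theory.
Import numFieldNormedType.Exports.
Local Open Scope classical_set_scope.
Local Open Scope ring_scope.

Notation Borel X := (g_sigma_algebraType (@open X)).

Definition full_support (X : ptopologicalType) (R : realType)
  (m : {measure set (Borel X) -> \bar R}) : Prop :=
  forall U : set X, open U -> U !=set0 -> m U <> 0%E.

Section DirichletDefs.
Context (X : ptopologicalType) (R : realType)
        (m : {measure set (Borel X) -> \bar R}).
Local Notation T := (Borel X).

Definition inL (p : \bar R) (f : T -> R) : Prop := f \in Lfun m p.
Definition L2 := inL 2%:E.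

Definition L2norm (f : T -> R) : \bar R := 'N[m]_2%:E [EFin \o f].

Definition inner2 (f g : T -> R) : R := Rintegral m setT (fun x => f x * g x).

Definition pospart (a : R) : R := Num.max a 0.
Definition negpart (a : R) : R := Num.max (- a) 0.

Definition L2_cvg (un : nat -> T -> R) (u : T -> R) : Prop :=
  (fun n => L2norm (un n \- u)) @ \oo --> 0%E.

Section Form.
Variable E : (T -> R) -> \bar R.

Definition L2_functional : Prop :=
  (forall u v, L2 u -> L2 v -> u = v %[ae m] -> E u = E v) /\
  (forall u, L2 u -> (0 <= E u)%E).

Definition convex_form : Prop :=
  forall u v (t : R), L2 u -> L2 v -> 0 < t < 1 ->
    (E (fun x => (t * u x + (1 - t) * v x)%R) <= t%:E * E u + (1 - t)%:E * E v)%E.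

Definition lsc_form : Prop :=
  forall (un : nat -> T -> R) u, L2 u -> (forall n, L2 (un n)) ->
    L2_cvg un u -> (E u <= limn_einf (fun n => E (un n)))%E.

Definition densely_defined : Prop :=
  forall u (e : R), L2 u -> 0 < e ->
    exists v, [/\ L2 v, (E v < +oo)%E & (L2norm (u \- v)%R < e%:E)%E].

Definition dirichlet_cond1 : Prop :=
  forall u v, L2 u -> L2 v ->
    (E (fun x => Num.min (u x) (v x)) + E (fun x => Num.max (u x) (v x))
       <= E u + E v)%E.

Definition dirichlet_cond2 : Prop :=
  forall u v (alpha : R), L2 u -> L2 v -> 0 < alpha ->
    let phi := fun x => 2^-1 * (pospart (u x - v x + alpha)
                                - negpart (u x - v x - alpha)) in
    (E (fun x => (v x + phi x)%R) + E (fun x => (u x - phi x)%R) <= E u + E v)%E.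

Definition dirichlet_form : Prop :=
  [/\ L2_functional, convex_form, lsc_form & densely_defined] /\
  (dirichlet_cond1 /\ dirichlet_cond2).

Definition even_form : Prop :=
  E (fun _ => 0) = 0%E /\ forall u, L2 u -> E (fun x => - u x) = E u.

Definition growth_type_at_most (r : R) : Prop :=
  forall u (lam : R), L2 u -> 1 <= lam ->
    (E (fun x => (lam * u x)%R) <= (lam `^ r)%:E * E u)%E.

Definition subgradient (u f : T -> R) : Prop :=
  [/\ L2 u, L2 f, (E u < +oo)%E &
      forall v, L2 v -> ((inner2 f (v \- u)%R)%:E <= E v - E u)%E].

Definition E1 (u : T -> R) : \bar R := (L2norm u * L2norm u + E u)%E.

Definition dspace (u : T -> R) : Prop :=
  L2 u /\ exists lam : R, 0 < lam /\ (E1 (fun x => (lam * u x)%R) < +oo)%E.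

Definition dnorm (u : T -> R) : \bar R :=
  ereal_inf [set lam%:E | lam in [set lam : R | 0 < lam /\
                               (E1 (fun x => (u x / lam)%R) <= 1)%E]].

Definition embeds_into_L (p : R) : Prop :=
  (forall u, dspace u -> inL p%:E u) /\
  exists c : R, forall u, dspace u -> ('N[m]_p%:E [EFin \o u] <= c%:E * dnorm u)%E.

End Form.
End DirichletDefs.

(* Main.v *)
(* Let w be half of the excess of u beyond the level k (the function [shrink k]
   of u below). Condition (2) with v = 0 and alpha = k says
   E(u - w) + E(w) <= E(u), so testing the subgradient inequality with u - w gives
   E(w) + lam |w|^2 <= (4 lam)^-1 \int_{|u| > k} f^2, and the right-hand side is at
   most a multiple of m(|u| > k)^(1 - 2/q). By the growth condition the Dirichlet
   norm of w is O(E_1(w)^(1/r)), and the embedding into L^p together with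
   Chebyshev's inequality yields, for 1 <= k < h,
   (h - k)^p m(|u| > h) <= M m(|u| > k)^((1 - 2/q) p / r).
   As the exponent exceeds 1, Stampacchia's lemma makes m(|u| > h) vanish for some
   finite h. *)
Require Import Defs.
From HB Require Import structures.
From mathcomp Require Import all_boot all_order all_algebra.
From mathcomp Require Import all_classical all_reals all_analysis.
From mathcomp Require Import measurable_realfun hoelder ess_sup_inf.
From mathcomp Require Import ring lra.
Set Implicit Arguments.
Unset Strict Implicit.
Unset Printing Implicit Defensive.
Import Order.TTheory GRing.Theory Num.Theory.
Import numFieldNormedType.Exports.
Local Open Scope classical_set_scope.
Local Open Scope ring_scope.

(** * Half soft-thresholding at level [k]: pointwise bounds *)

(* Kept in this unsimplified form so that it is convertible to [u x - phi x] in
   [dirichlet_cond2] for [v = 0] and [alpha = k]. *)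
Definition shrink (R : realType) (k a : R) : R :=
  a - 2^-1 * (pospart (a - 0 + k) - negpart (a - 0 - k)).

Lemma shrinkE (R : realType) (k a : R) : 0 < k ->
  shrink k a = if a < - k then (a + k) / 2 else if k < a then (a - k) / 2 else 0.
Proof.
move=> k0; rewrite /shrink /pospart /negpart !maxEle subr0.
by case: ifPn => ?; case: ifPn => ?; case: ifPn => ?; try case: ifPn => ?; lra.
Qed.

Lemma shrink_eq0 (R : realType) (k a : R) : 0 < k -> `|a| <= k -> shrink k a = 0.
Proof.
move=> k0; rewrite ler_norml shrinkE// => /andP[? ?].
by case: ifPn => ?; try case: ifPn => ?; lra.
Qed.

Lemma le_norm_shrink (R : realType) (k a : R) : 0 < k -> `|shrink k a| <= `|a|.
Proof.
move=> k0; rewrite shrinkE// ler_norml; have := ler_norm a.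
have : - a <= `|a| by rewrite -normrN ler_norm.
by case: ifPn => ?; try case: ifPn => ?; move=> *; apply/andP; split; lra.
Qed.

Lemma le_norm_sub_shrink (R : realType) (k a : R) :
  0 < k -> `|a - shrink k a| <= `|a|.
Proof.
move=> k0; rewrite shrinkE// ler_norml; have := ler_norm a.
have : - a <= `|a| by rewrite -normrN ler_norm.
by case: ifPn => ?; try case: ifPn => ?; move=> *; apply/andP; split; lra.
Qed.

(** Feeds Chebyshev's inequality: on the higher level set the truncation at [k] stays away from 0.
    The factor 1/2 in [shrink] reappears here and later in the constant [M]. *)
Lemma norm_shrink_ge (R : realType) (k h a : R) :
  0 < k -> k < h -> h < `|a| -> (h - k) / 2 <= `|shrink k a|.
Proof.
move=> k0 kh; rewrite shrinkE//; case: (ger0P a) => a0 ha.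
  rewrite ifN; last by rewrite -leNgt; lra.
  by rewrite ifT ?ger0_norm; lra.
by rewrite ifT ?ler0_norm; lra.
Qed.

(** Write s for [shrink k a]. If |a| <= k, both sides vanish. Otherwise s has the sign of a and a s
    >= 2 s^2, so -l a s contributes -2 l s^2; Young's inequality b s <= b^2 / (4 l) + l s^2 spends
    half of it and leaves -l s^2. *)
Lemma shrink_energy_le (R : realType) (l k a b : R) : 0 < l -> 0 < k ->
  (b - l * a) * shrink k a
    <= (4 * l)^-1 * (if k < `|a| then b ^+ 2 else 0) - l * shrink k a ^+ 2.
Proof.
move=> l0 k0; case: ifPn => ka; last first.
  have -> : shrink k a = 0 by apply: shrink_eq0 => //; rewrite leNgt.
  by rewrite expr2 !mulr0 subr0.
have sa : 2 * shrink k a ^+ 2 <= a * shrink k a.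
  by rewrite shrinkE//; case: ifPn => ?; [|case: ifPn => ?]; nra.
set s := shrink k a in sa *.
have l4 : 0 < (4 * l)^-1 by rewrite invr_gt0; lra.
suff : b * s <= (4 * l)^-1 * b ^+ 2 + l * s ^+ 2.
  by move=> H; have := ler_wpM2l (ltW l0) sa; lra.
rewrite -subr_ge0 (_ : _ - _ = (4 * l)^-1 * (b - 2 * l * s) ^+ 2).
  by rewrite mulr_ge0 ?sqr_ge0 ?ltW.
by field; rewrite gt_eqF.
Qed.

Lemma measurable_shrink (R : realType) (k : R) :
  measurable_fun setT (shrink k : R -> R).
Proof.
apply: measurable_funB => //; apply: measurable_funM => //.
apply: measurable_funB; apply: measurable_maxr => //.
- by apply: measurable_funD => //; exact: measurable_funB.
- apply: measurableT_comp => //; apply: measurable_funB => //.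
  exact: measurable_funB.
Qed.

(** * Measurability, membership in L^p and integrability *)

Lemma measurable_absgt (d : measure_display) (T : measurableType d)
    (R : realType) (u : T -> R) (k : R) :
  measurable_fun setT u -> measurable [set x | k < `|u x|].
Proof.
move=> mu; have mn : measurable_fun setT (fun x => `|u x|).
  exact: measurableT_comp.
rewrite (_ : [set _ | _] = (fun x => `|u x|) @^-1` `]k, +oo[).
  by rewrite -[X in measurable X]setTI; exact: mn.
by apply/seteqP; split => x /=; rewrite in_itv/= andbT.
Qed.

Lemma Lfun_measurable (d : measure_display) (T : measurableType d) (R : realType)
    (m : {measure set T -> \bar R}) (r : \bar R) (f : T -> R) :
  f \in Lfun m r -> measurable_fun setT f.
Proof. by rewrite inE => /andP[/[!inE]]. Qed.

Lemma Lfun_norm_lty (d : measure_display) (T : measurableType d) (R : realType)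
    (m : {measure set T -> \bar R}) (r : \bar R) (f : T -> R) :
  f \in Lfun m r -> ('N[m]_r [EFin \o f] < +oo)%E.
Proof. by rewrite inE => /andP[_ /[!inE]]. Qed.

Lemma Lfun_intro (d : measure_display) (T : measurableType d) (R : realType)
    (m : {measure set T -> \bar R}) (r : \bar R) (f : T -> R) :
  measurable_fun setT f -> ('N[m]_r [EFin \o f] < +oo)%E -> f \in Lfun m r.
Proof. by move=> mf nf; apply/andP; split; rewrite inE. Qed.

Lemma Lfun_dominated (d : measure_display) (T : measurableType d) (R : realType)
    (m : {measure set T -> \bar R}) (r : R) (f g : T -> R) : 0 <= r ->
  f \in Lfun m r%:E -> measurable_fun setT g -> (forall x, `|g x| <= `|f x|) ->
  g \in Lfun m r%:E.
Proof.
move=> r0 Lf mg gf; apply: Lfun_intro => //.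
apply: le_lt_trans (Lfun_norm_lty Lf); rewrite unlock /Lnorm.
have mpow (h : T -> R) : measurable_fun setT h ->
    measurable_fun setT (fun x => (`|h x| `^ r)%:E).
  move=> mh; apply/measurable_EFinP.
  apply: (@measurableT_comp _ _ _ _ _ _ (fun x => x `^ r)) => //.
  exact: measurableT_comp.
have pow0 (h : T -> R) x : setT x -> (0 <= (`|h x| `^ r)%:E)%E.
  by rewrite lee_fin powR_ge0.
apply: gt0_ler_poweR; rewrite ?invr_ge0// ?in_itv/= ?leey ?andbT.
- by apply: integral_ge0; exact: pow0.
- by apply: integral_ge0; exact: pow0.
apply: ge0_le_integral => //.
- exact: mpow.
- by apply: mpow; exact: Lfun_measurable Lf.
- by move=> x _ /=; rewrite lee_fin ge0_ler_powR// nnegrE.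
Qed.

Lemma integrable_mul_L2 (d : measure_display) (T : measurableType d) (R : realType)
    (m : {measure set T -> \bar R}) (f g : T -> R) :
  f \in Lfun m 2%:E -> g \in Lfun m 2%:E ->
  m.-integrable setT (EFin \o (fun x => f x * g x)).
Proof. by move=> Lf Lg; apply/Lfun1_integrable; exact: Lfun2_mul_Lfun1. Qed.

Lemma L2norm_sqr (X : ptopologicalType) (R : realType)
    (m : {measure set (Borel X) -> \bar R}) (w : Borel X -> R) : L2 m w ->
  (L2norm m w * L2norm m w)%E = (\int[m]_x (w x ^+ 2))%:E.
Proof.
move=> Lw; have N2 := @poweR_Lnorm _ _ _ m (EFin \o w) 2 (lt0r_neq0 (ltr0Sn R 1)).
have Nf : ('N[m]_2%:E [EFin \o w])%E \is a fin_num.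
  by rewrite ge0_fin_numE ?Lnorm_ge0// Lfun_norm_lty.
rewrite /L2norm -(fineK Nf) -EFinM -expr2; congr EFin.
have N0 : 0 <= fine ('N[m]_2%:E [EFin \o w])%E by rewrite fine_ge0// Lnorm_ge0.
rewrite -powR_mulrn// -fine_poweR N2 /Rintegral; congr fine.
by apply: eq_integral => x _ /=; rewrite powR_mulrn// real_normK ?num_real.
Qed.

Lemma shrink_L2 (d : measure_display) (T : measurableType d) (R : realType)
    (m : {measure set T -> \bar R}) (u : T -> R) (k : R) : 0 < k ->
  u \in Lfun m 2%:E -> (fun x => shrink k (u x)) \in Lfun m 2%:E.
Proof.
move=> k0 Lu; apply: (Lfun_dominated _ Lu) => //.
- apply: (@measurableT_comp _ _ _ _ _ _ (shrink k)).
    exact: measurable_shrink.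
  exact: Lfun_measurable Lu.
- by move=> x; exact: le_norm_shrink.
Qed.

Lemma Rintegral_absgt (d : measure_display) (T : measurableType d)
    (R : realType) (m : {measure set T -> \bar R}) (u g : T -> R) (k : R) :
  \int[m]_(x in [set x | k < `|u x|]) g x
    = \int[m]_x (if k < `|u x| then g x else 0).
Proof.
rewrite Rintegral_mkcond; congr Rintegral; apply/funext => x; rewrite patchE.
by rewrite (_ : (x \in _) = (k < `|u x|))//; apply/idP/idP; rewrite inE.
Qed.

Lemma integrable_EFinZl (d : measure_display) (T : measurableType d)
    (R : realType) (m : {measure set T -> \bar R}) (c : R) (g : T -> R) :
  m.-integrable setT (EFin \o g) ->
  m.-integrable setT (EFin \o (fun x => c * g x)).
Proof. exact: integrableZl. Qed.

Lemma integrable_EFinB (d : measure_display) (T : measurableType d)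
    (R : realType) (m : {measure set T -> \bar R}) (g h : T -> R) :
  m.-integrable setT (EFin \o g) -> m.-integrable setT (EFin \o h) ->
  m.-integrable setT (EFin \o (fun x => g x - h x)).
Proof. exact: integrableB. Qed.

(** * Energy estimate for the truncation *)

(** Condition (2) gives E(w) <= E(u) - E(u - w), and the subgradient inequality at u - w bounds this
    difference by the integral of (f - lam u) w. Integrating [shrink_energy_le] then yields the
    claim. *)
Lemma shrink_energy (X : ptopologicalType) (R : realType)
    (m : {measure set (Borel X) -> \bar R}) (E : (Borel X -> R) -> \bar R)
    (lam k : R) (f u : Borel X -> R) (w := fun x => shrink k (u x)) :
  (forall v, L2 m v -> (0 <= E v)%E) -> dirichlet_cond2 m E ->
  E (fun=> 0) = 0%E -> 0 < lam -> L2 m f ->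
  subgradient m E u (fun x => f x - lam * u x) -> 0 < k ->
  (E w + (lam * \int[m]_x (w x ^+ 2))%:E
    <= ((4 * lam)^-1 * \int[m]_(x in [set x | k < `|u x|]) (f x ^+ 2))%:E)%E.
Proof.
move=> E0 C2 Ez lam0 Lf [Lu Lg Eu sub] k0.
have Lw : L2 m w by exact: shrink_L2.
have L0 : L2 m (fun=> 0).
  apply: (Lfun_dominated _ Lu) => // x; by rewrite normr0.
have := C2 u (fun=> 0) k Lu L0 k0; rewrite Ez adde0 /=.
rewrite -[X in (_ + E X)%E]/w.
set v := (X in (E X + _ <= _)%E) => Evw.
have vE x : v x = u x - w x by rewrite /v /w /shrink add0r; ring.
have Lv : L2 m v.
  apply: (Lfun_dominated _ Lu) => //.
    rewrite (_ : v = u \- w); last by apply/funext => x; exact: vE.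
    by apply: measurable_funB; [exact: Lfun_measurable Lu|exact: Lfun_measurable Lw].
  by move=> x; rewrite vE; exact: le_norm_sub_shrink.
(* All three energies are finite, being nonnegative and controlled by E(u), so the two inequalities
   can be combined over the reals. *)
have Ev0 := E0 _ Lv; have Ew0 := E0 _ Lw; have Eu0 := E0 _ Lu.
have Euf : E u \is a fin_num by rewrite ge0_fin_numE.
have Ewf : E w \is a fin_num.
  by rewrite ge0_fin_numE//; apply: le_lt_trans Eu; rewrite (le_trans _ Evw)// leeDr.
have Evf : E v \is a fin_num.
  by rewrite ge0_fin_numE//; apply: le_lt_trans Eu; rewrite (le_trans _ Evw)// leeDl.
have := sub v Lv; move: Evw.
rewrite -(fineK Euf) -(fineK Ewf) -(fineK Evf) -!EFinD !lee_fin => Evw subv.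
have gwE : inner2 m (fun x => f x - lam * u x) (v \- u)
    = - \int[m]_x ((f x - lam * u x) * w x).
  rewrite -mulN1r -RintegralZl//; last exact: integrable_mul_L2.
  by apply: eq_Rintegral => x _ /=; rewrite vE; ring.
have mA : measurable [set x | k < `|u x|].
  by apply: measurable_absgt; exact: Lfun_measurable Lu.
have If := Lfun2_integrable_sqr Lf; have Iw := Lfun2_integrable_sqr Lw.
have IA : m.-integrable setT
    (EFin \o (fun x => if k < `|u x| then f x ^+ 2 else 0)).
  apply: le_integrable If => //.
    apply/measurable_EFinP; apply: measurable_fun_ifT => //.
      rewrite (_ : (fun x => _) = (fun x => k < x) \o (fun x => `|u x|))//.
      apply: measurable_fun_ltr => //; apply: measurableT_comp => //.
      exact: Lfun_measurable Lu.
    by apply: measurable_funX; exact: Lfun_measurable Lf.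
  by move=> x _ /=; case: ifPn => // _; rewrite lee_fin normr0.
have : \int[m]_x ((f x - lam * u x) * w x) <=
   (4 * lam)^-1 * \int[m]_(x in [set x | k < `|u x|]) (f x ^+ 2)
    - lam * \int[m]_x (w x ^+ 2).
  rewrite Rintegral_absgt.
  rewrite -!RintegralZl// -RintegralB//; last 2 first.
  - exact: integrable_EFinZl.
  - exact: integrable_EFinZl.
  apply: le_Rintegral => //.
  - exact: integrable_mul_L2.
  - by apply: integrable_EFinB; exact: integrable_EFinZl.
  - by move=> x _; exact: shrink_energy_le.
by rewrite gwE in subv; lra.
Qed.

(** * From energy to the Dirichlet norm *)

Lemma powRV (R : realType) (a x : R) : 0 <= a -> a^-1 `^ x = (a `^ x)^-1.
Proof. by move=> a0; rewrite -powR_inv1// -powRrM mulN1r powRN. Qed.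

Lemma L2_scale (X : ptopologicalType) (R : realType)
    (m : {measure set (Borel X) -> \bar R}) (c : R) (w : Borel X -> R) :
  L2 m w -> L2 m (fun x => c * w x).
Proof.
move=> Lw; have c1 : 1 <= (2 : R) by lra.
rewrite (_ : (fun x => _) = (c \o* w)); first exact: Lfun_scale.
by apply/funext => x /=; rewrite mulrC.
Qed.

(* [w / mu] is reached from [w] by first dividing by [K >= 1], where convexity
   gains the factor [1 / K], and then multiplying by [(K / A) `^ r^-1 >= 1],
   where the growth condition costs the factor [K / A]. *)
Lemma dnorm_le (X : ptopologicalType) (R : realType)
    (m : {measure set (Borel X) -> \bar R}) (E : (Borel X -> R) -> \bar R)
    (r A K : R) (w : Borel X -> R) :
  (forall v, L2 m v -> (0 <= E v)%E) -> convex_form m E ->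
  E (fun=> 0) = 0%E -> 2 <= r -> growth_type_at_most m E r ->
  L2 m w -> (E1 m E w <= A%:E)%E -> 0 < A -> A <= K -> 1 <= K ->
  (dnorm m E w <= (K * (A / K) `^ r^-1)%:E)%E.
Proof.
move=> E0 convE Ez r2 gr Lw + A0 AK K1.
have K0 : 0 < K by lra.
have L0 : L2 m (fun=> 0).
  by apply: (Lfun_dominated _ Lw) => // x; rewrite normr0.
have Ew0 := E0 _ Lw.
rewrite /E1 L2norm_sqr//; set I := Rintegral _ _ _ => E1w.
have I0 : 0 <= I by apply: Rintegral_ge0 => x _; exact: sqr_ge0.
have Ewf : E w \is a fin_num.
  rewrite ge0_fin_numE//; apply: le_lt_trans (ltry A).
  by apply: le_trans E1w; rewrite leeDr// lee_fin.
move: E1w Ew0; rewrite -(fineK Ewf) -EFinD !lee_fin; set e := fine _ => IeA e0.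
set l := (K / A) `^ r^-1; set mu := K * _.
have l1 : 1 <= l.
  have -> : 1 = 1 `^ r^-1 :> R by rewrite powR1.
  rewrite ge0_ler_powR ?nnegrE ?invr_ge0 ?divr_ge0//; try lra.
  by rewrite ler_pdivlMr// mul1r.
have lr : l `^ r = K / A.
  have r0 : 0 < r by lra.
  by rewrite /l -powRrM mulVf ?gt_eqF// powRr1// divr_ge0// ltW.
have muE : mu = K / l.
  by rewrite /mu -(invf_div K A) powRV// divr_ge0// ltW.
have mu0 : 0 < mu by rewrite muE divr_gt0//; lra.
have wK : (E (fun x => K^-1 * w x)%R <= (K^-1 * e)%:E)%E.
  (* [convex_form] only speaks of weights strictly between 0 and 1, so K = 1 is treated apart. *)
  move: K1; rewrite le_eqVlt => /predU1P[<-|K1].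
    rewrite invr1 mul1r fineK//.
    by under [X in E X]eq_fun do rewrite mul1r.
  have t01 : 0 < K^-1 < 1 by rewrite invr_gt0 K0 invf_lt1.
  have := convE w (fun=> 0) K^-1 Lw L0 t01.
  rewrite Ez mule0 adde0 -(fineK Ewf) -EFinM.
  by under eq_fun do rewrite mulr0 addr0.
apply: ereal_inf_lbound; exists mu => //; split => //.
have -> : (fun x => w x / mu) = (fun x => l * (K^-1 * w x)).
  by apply/funext => x; rewrite muE invf_div; ring.
have LK : L2 m (fun x => K^-1 * w x) by exact: L2_scale.
rewrite /E1 L2norm_sqr; last exact: L2_scale.
have -> : \int[m]_x (l * (K^-1 * w x)) ^+ 2 = (l / K) ^+ 2 * I.
  rewrite -RintegralZl//; last exact: Lfun2_integrable_sqr.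
  by apply: eq_Rintegral => x _; ring.
apply: (@le_trans _ _ ((l / K) ^+ 2 * I + (K / A) * (K^-1 * e))%:E).
  rewrite EFinD leeD2l// (le_trans (gr _ _ LK l1))// lr (EFinM (K / A)).
  by rewrite lee_pmul2l// lte_fin divr_gt0.
rewrite lee_fin.
(* This is where r >= 2 enters: as l >= 1, l^2 <= l^r = K / A, so the quadratic part of [E1] also
   shrinks at least by the factor 1 / A. *)
have l2 : l ^+ 2 <= K / A by rewrite -lr -powR_mulrn ?ler_powR//; lra.
have h1 : (l / K) ^+ 2 <= A^-1.
  rewrite expr_div_n ler_pdivrMr ?exprn_gt0// (le_trans l2)//.
  rewrite mulrC ler_pM2l ?invr_gt0// expr2.
  by rewrite -[leLHS]mulr1 ler_pM2l.
have -> : K / A * (K^-1 * e) = A^-1 * e by field; rewrite !gt_eqF.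
apply: (@le_trans _ _ (A^-1 * I + A^-1 * e)); first by rewrite lerD2r ler_wpM2r.
by rewrite -mulrDr mulrC ler_pdivrMr// mul1r.
Qed.

(** * Chebyshev and Hoelder type estimates on a set *)

Lemma Lnorm_chebyshev (d : measure_display) (T : measurableType d)
    (R : realType) (m : {measure set T -> \bar R}) (p t : R) (w : T -> R)
    (A : set T) : 0 < p -> 0 <= t -> measurable_fun setT w -> measurable A ->
  (forall x, A x -> t <= `|w x|) ->
  ((t `^ p)%:E * m A <= ('N[m]_p%:E [EFin \o w]) `^ p)%E.
Proof.
move=> p0 t0 mw mA tw; rewrite poweR_Lnorm ?gt_eqF//.
have mpow : measurable_fun setT (fun x => (`|w x| `^ p)%:E).
  apply/measurable_EFinP.
  apply: (@measurableT_comp _ _ _ _ _ _ (fun x => x `^ p)) => //.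
  exact: measurableT_comp.
rewrite -integral_cst//.
apply: (@le_trans _ _ (\int[m]_(x in A) (`|w x| `^ p)%:E)%E).
  apply: ge0_le_integral => //.
  - by move=> x _; rewrite lee_fin powR_ge0.
  - exact: measurable_funS mpow.
  - by move=> x Ax; rewrite lee_fin ge0_ler_powR ?nnegrE ?tw// ltW.
by apply: ge0_subset_integral => // x _; rewrite lee_fin powR_ge0.
Qed.

(** Split at |a| = t: below, a^2 <= t^2; above, |a|^(2 - q) <= t^(2 - q) because 2 - q <= 0. The
    free parameter t makes this a substitute for Hoelder's inequality. *)
Lemma sqr_le_powR (R : realType) (q t a : R) : 2 <= q -> 0 < t ->
  a ^+ 2 <= t ^+ 2 + t `^ (2 - q) * `|a| `^ q.
Proof.
move=> q2 t0; rewrite -(real_normK (num_real a)).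
have [at_|ta] := lerP `|a| t.
  rewrite -[leLHS]addr0 lerD ?mulr_ge0 ?powR_ge0// ler_sqr ?nnegrE//.
  exact: ltW.
have a0 : 0 < `|a| by lra.
rewrite -[leLHS]add0r lerD ?sqr_ge0//.
have -> : `|a| ^+ 2 = `|a| `^ (2 - q) * `|a| `^ q.
  by rewrite -powRD ?subrK ?powR_mulrn// lt0r_neq0// implybT.
rewrite ler_wpM2r ?powR_ge0//.
rewrite -(opprB q) !powRN lef_pV2 ?posrE ?powR_gt0//.
by rewrite ge0_ler_powR ?nnegrE//; lra.
Qed.

(** Integrate [sqr_le_powR] over [A] and choose t. The bound [F] stands in for the integral of |f|^q
    so that it can be taken positive even when f vanishes almost everywhere. *)
Lemma Rintegral_sqr_le (d : measure_display) (T : measurableType d)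
    (R : realType) (m : {measure set T -> \bar R}) (q F : R) (f : T -> R)
    (A : set T) : 2 <= q -> f \in Lfun m 2%:E -> f \in Lfun m q%:E ->
  \int[m]_x (`|f x| `^ q) <= F -> 0 < F ->
  measurable A -> m A \is a fin_num -> 0 < fine (m A) ->
  \int[m]_(x in A) (f x ^+ 2)
    <= 2 * F `^ (2 / q) * fine (m A) `^ (1 - 2 / q).
Proof.
move=> q2 L2f Lqf fF F0 mA Af A0; set a := fine (m A) in A0 *.
have q0 : 0 < q by lra.
(* This choice of [t] equalises the two terms of [sqr_le_powR] after
   integration, which gives Hoelder's exponents up to the factor 2. *)
set t := (F / a) `^ q^-1.
have t0 : 0 < t by rewrite powR_gt0// divr_gt0.
have q1 : 1 <= q by lra.
have Iq := Lfun_integrable q1 Lqf.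
have IqA : m.-integrable A (EFin \o (fun x => `|f x| `^ q)).
  exact: integrableS Iq.
have IcA : m.-integrable A (EFin \o cst (t ^+ 2)).
  apply/integrableP; split; first exact/measurable_EFinP.
  under eq_integral do rewrite /= ger0_norm ?sqr_ge0//.
  by rewrite integral_cst// lte_mul_pinfty ?lee_fin ?sqr_ge0// -ge0_fin_numE.
have IA : m.-integrable A (EFin \o (fun x => t `^ (2 - q) * `|f x| `^ q)).
  exact: (integrableZl mA _ IqA).
apply: (@le_trans _ _ (\int[m]_(x in A) (t ^+ 2 + t `^ (2 - q) * `|f x| `^ q))).
  apply: le_Rintegral => //.
  - by apply: integrableS (Lfun2_integrable_sqr L2f).
  - exact: (integrableD mA IcA IA).
  - by move=> x _; exact: sqr_le_powR.
rewrite RintegralD// Rintegral_cst// RintegralZl// -/a.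
have fFA : \int[m]_(x in A) (`|f x| `^ q) <= F.
  apply: le_trans fF; apply: fine_le.
  - exact: integrable_fin_num.
  - exact: integrable_fin_num.
  - by apply: ge0_subset_integral => //; case/integrableP: Iq.
apply: (@le_trans _ _ (t ^+ 2 * a + t `^ (2 - q) * F)).
  by rewrite lerD2l ler_wpM2l// powR_ge0.
have t2 : t ^+ 2 = F `^ (2 / q) / a `^ (2 / q).
  rewrite -powR_mulrn ?ltW// /t -powRrM (mulrC _ 2) powRM ?invr_ge0 ?ltW//.
  by rewrite powRV ?ltW.
have tq : t `^ q = F / a.
  by rewrite /t -powRrM mulVf ?gt_eqF// powRr1// divr_ge0// ltW.
(* Since t^q = F / a, the term t^(2 - q) F equals t^2 a, and the sum is 2 t^2 a. *)
rewrite powRB ?(lt0r_neq0 t0) ?(lt0r_neq0 A0) ?implybT// tq powR_mulrn ?(ltW t0)// t2.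
rewrite powRB ?(lt0r_neq0 t0) ?(lt0r_neq0 A0) ?implybT// powRr1 ?(ltW A0)//.
rewrite le_eqVlt; apply/orP; left; apply/eqP; field.
by rewrite !gt_eqF// ?powR_gt0.
Qed.

(** * Stampacchia's lemma *)

Lemma powR_exprn (R : realType) (a p : R) (n : nat) : 0 <= a ->
  (a ^+ n) `^ p = (a `^ p) ^+ n.
Proof. by move=> a0; rewrite -!powR_mulrn ?powR_ge0// powRAC. Qed.

(* Along [k n = k0 + d * (1 - 2 ^- n)] the values [phi (k n)] decay geometrically
   with ratio [rho = 2 `^ (- p / (b - 1))], chosen so that [rho `^ (b - 1)]
   absorbs the factor [2 `^ p] lost at each halving of the step. *)
Lemma stampacchia (R : realType) (phi : R -> R) (k0 M p b : R) :
  0 < p -> 1 < b -> 0 <= M -> (forall k, k0 <= k -> 0 <= phi k) ->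
  (forall k h, k0 <= k -> k <= h -> phi h <= phi k) ->
  (forall k h, k0 <= k -> k < h -> (h - k) `^ p * phi h <= M * phi k `^ b) ->
  exists2 d, 0 <= d & phi (k0 + d) = 0.
Proof.
move=> p0 b1 M0 phi0 phi_dec phi_rec.
have := phi0 k0 (lexx _); rewrite le_eqVlt => /predU1P[Z|F0].
  by exists 0; rewrite ?addr0.
set F := phi k0 in F0.
have b0 : 0 < b by lra.
have M1 : 0 < M + 1 by lra.
have p_neq0 : p != 0 by rewrite gt_eqF.
have b_neq0 : b - 1 != 0 by rewrite gt_eqF ?subr_gt0.
set rho := 2 `^ (- (p / (b - 1))) : R.
set c := 2 `^ (- p) : R.
have rho0 : 0 < rho by rewrite powR_gt0.
have c0 : 0 < c by rewrite powR_gt0.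
have rho1 : rho < 1.
  have s0 : 0 < p / (b - 1) by rewrite divr_gt0 ?subr_gt0.
  rewrite /rho powRN invf_lt1 ?powR_gt0//.
  apply: (@le_lt_trans _ _ (1 `^ (p / (b - 1)))); first by rewrite powR1.
  by rewrite gt0_ltr_powR ?nnegrE//; lra.
have rhob : rho `^ b = rho * c.
  rewrite -[b in LHS](subrK 1) powRD; last by rewrite (lt0r_neq0 rho0) implybT.
  rewrite (powRr1 (ltW rho0)) mulrC; congr (_ * _).
  by rewrite /rho /c -powRrM mulNr divfK.
(* [D] is the value of d^p for which the recursion carries the bound F rho^n to F rho^(n+1); M + 1
   replaces M to keep [D] positive when M = 0. *)
set D := (M + 1) * F `^ (b - 1) / (c * rho).
have D0 : 0 < D.
  by rewrite divr_gt0 ?mulr_gt0 ?powR_gt0.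
set d := D `^ p^-1.
have d0 : 0 < d by rewrite powR_gt0.
have dp : d `^ p = D by rewrite /d -powRrM mulVf// powRr1// ltW.
pose k n : R := k0 + d * (1 - 2^-1 ^+ n).
have half_le1 n : (2^-1 : R) ^+ n <= 1.
  by apply: exprn_ile1; rewrite ?invr_ge0// invf_le1// ler1n.
have k_ge n : k0 <= k n.
  by rewrite /k lerDl mulr_ge0 ?(ltW d0)// subr_ge0.
have k_le n : k n <= k0 + d.
  by rewrite /k lerD2l -[leRHS]mulr1 ler_wpM2l ?(ltW d0)// gerBl.
have kS n : k n.+1 - k n = d * 2^-1 ^+ n.+1.
  by rewrite /k exprS; field.
have halfp n : (2^-1 ^+ n) `^ p = c ^+ n :> R.
  by rewrite powR_exprn ?invr_ge0// powRV// -powRN.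
have decay n : phi (k n) <= F * rho ^+ n.
  elim: n => [|n IHn].
    by rewrite /k expr0 subrr mulr0 addr0 mulr1.
  have kn : k n < k n.+1.
    by rewrite -subr_gt0 kS mulr_gt0// exprn_gt0// invr_gt0.
  have := phi_rec _ _ (k_ge n) kn.
  rewrite kS powRM ?(ltW d0)//.
  rewrite dp halfp => rec.
  have : D * c ^+ n.+1 * phi (k n.+1) <= M * (F * rho ^+ n) `^ b.
    apply: le_trans rec _; rewrite ler_wpM2l// ge0_ler_powR ?nnegrE//.
    - exact: ltW.
    - exact: phi0.
    - by rewrite mulr_ge0 ?exprn_ge0// ltW.
  have -> : (F * rho ^+ n) `^ b = F * F `^ (b - 1) * (rho * c) ^+ n.
    rewrite powRM ?exprn_ge0 ?(ltW F0) ?(ltW rho0)// mulr_powRB1 ?(ltW F0)//.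
    by rewrite powR_exprn ?(ltW rho0)// rhob.
  set G := F `^ (b - 1).
  have G0 : 0 < G by rewrite powR_gt0.
  have -> : D * c ^+ n.+1 = (M + 1) * G * c ^+ n / rho.
    by rewrite /D -/G exprS; field; rewrite !gt_eqF.
  have cn0 : 0 < c ^+ n by rewrite exprn_gt0.
  have -> : (M + 1) * G * c ^+ n / rho * phi (k n.+1)
      = ((M + 1) * phi (k n.+1)) * (G * c ^+ n / rho) by ring.
  have -> : M * (F * G * (rho * c) ^+ n)
      = (M * (F * rho ^+ n.+1)) * (G * c ^+ n / rho).
    by rewrite exprMn exprS; field; rewrite gt_eqF.
  rewrite ler_pM2r ?divr_gt0 ?mulr_gt0// => H.
  have Z0 : 0 <= F * rho ^+ n.+1 by rewrite mulr_ge0 ?exprn_ge0// ltW.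
  by rewrite -(ler_pM2l M1) (le_trans H)// ler_wpM2r// lerDl.
exists d; first exact: ltW.
have dge : k0 <= k0 + d by rewrite lerDl ltW.
(* Were phi (k0 + d) positive, some F rho^N would lie below it, against phi (k0 + d) <= phi (k N) <=
   F rho^N. *)
have := phi0 _ dge; rewrite le_eqVlt => /predU1P[//|pos].
have cvg : geometric F rho @ \oo --> 0.
  by apply: cvg_geometric; rewrite ger0_norm// ltW.
have [N _ /(_ N (leqnn N))] := cvgr_lt _ cvg _ pos.
rewrite /geometric /= => H.
have := le_trans (phi_dec _ _ (k_ge N) (k_le N)) (decay N).
by rewrite leNgt H.
Qed.

(** * Level sets of [u] and conclusion *)

Lemma dnorm_ge0 (X : ptopologicalType) (R : realType)
    (m : {measure set (Borel X) -> \bar R}) (E : (Borel X -> R) -> \bar R)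
    (w : Borel X -> R) : (0 <= dnorm m E w)%E.
Proof. by apply: le_ereal_inf_tmp => _ [l [l0 _] <-]; rewrite lee_fin ltW. Qed.

(** Chebyshev's inequality in L^2. As [m] may be infinite, finiteness is only guaranteed at positive
    levels, which is why the iteration starts at level 1. *)
Lemma measure_absgt_fin_num (d : measure_display) (T : measurableType d)
    (R : realType) (m : {measure set T -> \bar R}) (u : T -> R) (k : R) :
  u \in Lfun m 2%:E -> 0 < k -> m [set x | k < `|u x|] \is a fin_num.
Proof.
move=> Lu k0; rewrite ge0_fin_numE//.
have mu := Lfun_measurable Lu.
have k20 : 0 < k `^ 2 by exact: powR_gt0.
have : ((k `^ 2)%:E * m [set x | (k < `|u x|)%R] < +oo)%E.
  apply: (@le_lt_trans _ _ (('N[m]_2%:E [EFin \o u]) `^ 2)%E).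
    apply: Lnorm_chebyshev => //; first exact: ltW.
    - exact: measurable_absgt.
    - by move=> x /= /ltW.
  by rewrite poweR_lty// Lfun_norm_lty.
have := measure_ge0 m [set x | (k < `|u x|)%R].
case: (m _) => [a _ _| _|]//; first exact: ltry.
by rewrite gt0_muley ?lte_fin.
Qed.

(** With I the integral of w^2, the product (1 + 1/lam) (E(w) + lam I) expands to E(w) + I plus
    nonnegative terms, so [shrink_energy] controls both parts of [E1]. *)
Lemma E1_shrink_le (X : ptopologicalType) (R : realType)
    (m : {measure set (Borel X) -> \bar R}) (E : (Borel X -> R) -> \bar R)
    (lam k : R) (f u : Borel X -> R) (w := fun x => shrink k (u x)) :
  (forall v, L2 m v -> (0 <= E v)%E) -> dirichlet_cond2 m E ->
  E (fun=> 0) = 0%E -> 0 < lam -> L2 m f ->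
  subgradient m E u (fun x => f x - lam * u x) -> 0 < k ->
  (E1 m E w <= ((1 + lam^-1) * ((4 * lam)^-1 *
    \int[m]_(x in [set x | k < `|u x|]) (f x ^+ 2)))%:E)%E.
Proof.
move=> E0 C2 Ez lam0 Lf sub k0.
have Lw : L2 m w by case: sub => Lu _ _ _; exact: shrink_L2.
have := E0 _ Lw.
have := shrink_energy E0 C2 Ez lam0 Lf sub k0.
rewrite -/w /E1 L2norm_sqr//.
have : 0 <= \int[m]_x (w x ^+ 2) by apply: Rintegral_ge0 => x _; exact: sqr_ge0.
case: (E w) => [e| |]//.
move: (Rintegral _ _ _) (Rintegral _ _ _) => J I I0.
rewrite -!EFinD !lee_fin => eJ e0.
have l0 : 0 < lam^-1 by rewrite invr_gt0.
apply: (@le_trans _ _ ((1 + lam^-1) * (e + lam * I))).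
  rewrite mulrDr mulrDl mul1r mulrDl mul1r mulKf ?gt_eqF//.
  by have := mulr_ge0 (ltW l0) e0; have := mulr_ge0 (ltW lam0) I0; lra.
by rewrite ler_pM2l// addr_gt0.
Qed.

Theorem mainTheorem7 (X : ptopologicalType) (R : realType)
  (m : {measure set (Borel X) -> \bar R})
  (hX : hausdorff_space X) (hm : full_support m)
  (E : (Borel X -> R) -> \bar R) (r q p lam : R) (f u : Borel X -> R) :
  dirichlet_form m E -> even_form m E -> 2 <= r -> growth_type_at_most m E r ->
  2 <= q -> 0 < lam -> L2 m f -> inL m q%:E f ->
  subgradient m E u (fun x => f x - lam * u x) ->
  2 <= p -> 1 < (1 - 2 / q) * (p / r) ->
  embeds_into_L m E p ->
  inL m +oo%E u.
Proof.
move=> [[[_ E0] convE _ _] [_ C2]] [Ez _] r2 gr q2 lam0 Lf Lqf sub p2 pqr.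
move=> [_ [c emb]].
have p0 : 0 < p by lra.
have r0 : 0 < r by lra.
have pr0 : 0 < p / r by rewrite divr_gt0.
have Lu : L2 m u by case: sub.
have mu := Lfun_measurable Lu.
have mA (k : R) : measurable [set x | k < `|u x|] by exact: measurable_absgt.
(* Adding 1 makes [F] positive also for f = 0. *)
set F := \int[m]_x (`|f x| `^ q) + 1.
have F0 : 0 < F.
  by rewrite ltr_pwDr// Rintegral_ge0// => x _; rewrite powR_ge0.
set gam : R := 1 - 2 / q in pqr.
(* [fine] sends an infinite measure to 0; this is harmless, since monotonicity and the recursion are
   only claimed for levels k >= 1. *)
pose phi (k : R) : R := fine (m [set x | k < `|u x|]).
have phi0 k : 0 <= phi k by rewrite fine_ge0.
have mAf k : 1 <= k -> m [set x | k < `|u x|] \is a fin_num.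
  by move=> k1; apply: measure_absgt_fin_num => //; exact: lt_le_trans k1.
have phi_dec k h : 1 <= k -> k <= h -> phi h <= phi k.
  move=> k1 kh; apply: fine_le; rewrite ?mAf//; first exact: le_trans kh.
  by apply: le_measure; rewrite ?inE// => x /=; exact: le_lt_trans.
set C1 : R := (1 + lam^-1) * (4 * lam)^-1.
have C10 : 0 < C1 by rewrite mulr_gt0 ?addr_gt0 ?invr_gt0 ?mulr_gt0.
set C := C1 * (2 * F `^ (2 / q)).
have C0 : 0 < C by apply: mulr_gt0 => //; rewrite mulr_gt0 ?powR_gt0.
(* A single [K] for all levels: it is at least 1, as [dnorm_le] requires, and dominates C phi(k)^gam
   for every k >= 1 because phi decreases. Hence [M] does not depend on k. *)
set K := 1 + C * phi 1 `^ gam.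
have K1 : 1 <= K by rewrite lerDl mulr_ge0 ?powR_ge0// ltW.
have K0 : 0 < K by exact: lt_le_trans K1.
have gam0 : 0 < gam by rewrite -(pmulr_lgt0 _ pr0) (lt_trans ltr01).
(* The 2 undoes the halving in [shrink]; the absolute value is taken because the sign of the
   embedding constant [c] is unspecified. *)
set M := (2 * (`|c| * K)) `^ p * (C / K) `^ (p / r).
have M0 : 0 <= M by rewrite mulr_ge0 ?powR_ge0.
have rec k h : 1 <= k -> k < h ->
    (h - k) `^ p * phi h <= M * phi k `^ (gam * (p / r)).
  move=> k1 kh; have k0 : 0 < k by exact: lt_le_trans k1.
  (* [dnorm_le] needs A > 0, so phi k = 0 is settled first by monotonicity. *)
  have := phi0 k; rewrite le_eqVlt => /predU1P[Z|a0].
    have -> : phi h = 0.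
      by apply/eqP; rewrite eq_le phi0 andbT Z phi_dec// ltW.
    by rewrite mulr0 mulr_ge0 ?powR_ge0.
  set w := fun x => shrink k (u x).
  have Lw : L2 m w by exact: shrink_L2.
  set A := C * phi k `^ gam.
  have A0 : 0 < A by rewrite mulr_gt0 ?powR_gt0.
  have AK : A <= K.
    rewrite /K -[leLHS]add0r lerD// ler_wpM2l ?(ltW C0)//.
    by rewrite ge0_ler_powR ?nnegrE ?phi_dec// ltW.
  have E1A : (E1 m E w <= A%:E)%E.
    apply: le_trans (E1_shrink_le E0 C2 Ez lam0 Lf sub k0) _.
    rewrite lee_fin /A /C /C1 -!mulrA ler_pM2l; last by rewrite addr_gt0 ?invr_gt0.
    rewrite ler_pM2l ?invr_gt0 ?mulr_gt0// mulrA.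
    by apply: Rintegral_sqr_le => //; [rewrite lerDl|exact: mAf].
  have Dw : dspace m E w.
    split => //; exists 1; split => //.
    under eq_fun do rewrite mul1r.
    exact: le_lt_trans E1A (ltry _).
  have Npw : ('N[m]_p%:E [EFin \o w] <= (`|c| * (K * (A / K) `^ r^-1))%:E)%E.
    apply: le_trans (emb _ Dw) _.
    have dn := dnorm_le E0 convE Ez r2 gr Lw E1A A0 AK K1.
    rewrite EFinM; apply: (@le_trans _ _ (`|c|%:E * dnorm m E w)%E).
      by rewrite lee_wpmul2r ?dnorm_ge0// lee_fin ler_norm.
    by rewrite lee_wpmul2l.
  have : ((h - k) / 2) `^ p * phi h <= (`|c| * (K * (A / K) `^ r^-1)) `^ p.
    have h1 : 1 <= h by rewrite (le_trans k1)// ltW.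
    rewrite -lee_fin EFinM fineK ?mAf//.
    apply: (@le_trans _ _ (('N[m]_p%:E [EFin \o w]) `^ p)%E).
      apply: Lnorm_chebyshev => //.
      - by rewrite divr_ge0// subr_ge0 ltW.
      - exact: Lfun_measurable Lw.
      - by move=> x /= hx; exact: norm_shrink_ge.
    rewrite -poweR_EFin; apply: gt0_ler_poweR => //; first exact: ltW.
      by rewrite in_itv/= leey Lnorm_ge0.
    by rewrite in_itv/= leey lee_fin !mulr_ge0 ?powR_ge0// ltW.
  have cK0 : 0 <= `|c| * K by rewrite mulr_ge0 ?(ltW K0).
  have -> : (`|c| * (K * (A / K) `^ r^-1)) `^ p
      = (`|c| * K) `^ p * ((C / K) `^ (p / r) * phi k `^ (gam * (p / r))).
    rewrite [`|c| * (K * _)]mulrA (powRM _ cK0) ?powR_ge0//; congr (_ * _).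
    rewrite -powRrM (mulrC r^-1) (_ : A / K = C / K * phi k `^ gam); last first.
      by rewrite /A; ring.
    by rewrite powRM ?powR_ge0 ?divr_ge0 ?(ltW C0) ?(ltW K0)// -powRrM.
  have t0 : 0 <= (h - k) / 2 by rewrite divr_ge0// subr_ge0 ltW.
  have hkE : h - k = 2 * ((h - k) / 2) by field.
  rewrite [in X in _ -> X]hkE /M; move: (_ / 2) t0 => t t0.
  rewrite (powRM _ (ler0n R 2) t0) (powRM _ (ler0n R 2) cK0) -!mulrA.
  by rewrite ler_pM2l// powR_gt0.
(* The hypothesis on the exponents says exactly that b = gam (p / r) exceeds 1. *)
have [d d0 phid] := stampacchia p0 pqr M0 (fun k _ => phi0 k) phi_dec rec.
have m0 : m [set x | 1 + d < `|u x|] = 0%E.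
  by rewrite -(fineK (mAf (1 + d) _)) ?lerDl//; congr EFin.
apply: Lfun_intro => //; rewrite unlock /Lnorm; case: ifPn => // _.
(* The level 1 + d is an essential bound for |u|, its level set being null. *)
apply: (@le_lt_trans _ _ (1 + d)%:E); last exact: ltry.
apply/ess_supP; exists [set x | 1 + d < `|u x|]; split => //.
by move=> x /= /negP; rewrite lee_fin -ltNge.
Qed.
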